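(* Let $q$ be a real number with $q\neq 0,\pm1$ and let $n$ be a positive integer. The $n$-th forward Gaussian Riemann difference ${_q}\Delta_n(x,h;f)$, i.e. the $n$-th generalized Riemann difference based at $x,x+h,x+qh,\ldots ,x+q^{n-1}h$, has the expression $${_q}\Delta_n(x,h;f)=\lambda_n\cdot {_q}\widetilde{\Delta}_n(x,h;f),$$ where $${_q}\widetilde{\Delta}_n(x,h;f)=\sum_{k=0}^{n-1}(-1)^kq^{\binom{k+1}{2}}\left[\begin{array}{c}n-1\\k\end{array}\right]_qf(x+q^{n-1-k}h)-(1-q)(1-q^2)\cdots (1-q^{n-1})f(x)$$ and $\lambda_n=n!/\left((q^n-q)(q^n-q^2)\cdots (q^n-q^{n-1})\right)$.
   Context: An $n$-th generalized Riemann difference is $\Delta_{\mathcal{A}}(x,h;f)=\sum_{k=0}^{\ell}A_kf(x+a_kh)$, where the real numbers $A_k$ are non-zero, the real numbers $a_k$ are distinct, and $\sum_{k=0}^{\ell}A_ka_k^j=\delta_{j,n}\cdot n!$ for $j=0,1,\ldots ,n$ (with $0^0=1$). The points $x+a_kh$ are its base points. When there are exactly $n+1$ base points, the $A_k$ are uniquely determined by the $a_k$. Quantum integers and Gaussian binomial coefficients: $[k]_q=1+q+\cdots +q^{k-1}$, $[k]_q!=[1]_q[2]_q\cdots [k]_q$ with $[0]_q!=1$, and $\left[\begin{array}{c}n\\k\end{array}\right]_q=\frac{[n]_q!}{[n-k]_q!\,[k]_q!}$ for $0\le k\le n$. Empty products equal $1$. *)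

(* Defs.v *)
From mathcomp Require Import all_boot all_order all_algebra.
From mathcomp Require Import reals.

Set Implicit Arguments.
Unset Strict Implicit.
Unset Printing Implicit Defensive.

Import Order.TTheory GRing.Theory Num.Theory.
Local Open Scope ring_scope.

(* An n-th generalized Riemann difference, given by its data {A_k; a_k}.
   The convention 0 ^+ 0 = 1 is the library's. *)
Record riemann_diff (R : realType) (n : nat) := RiemannDiff {
  rd_len : nat;
  rd_coef : 'I_rd_len.+1 -> R;
  rd_node : 'I_rd_len.+1 -> R;
  rd_coef_neq0 : forall k, rd_coef k != 0;
  rd_node_inj : injective rd_node;
  rd_moments : forall j : nat, (j <= n)%N ->
    \sum_(k < rd_len.+1) rd_coef k * rd_node k ^+ j = (j == n)%:R * n`!%:R
}.

Definition rd_eval (R : realType) (n : nat) (D : riemann_diff R n)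
    (x h : R) (f : R -> R) : R :=
  \sum_(k < (rd_len D).+1) rd_coef k * f (x + rd_node k * h).

(* The base points are x, x + h, x + q h, ..., x + q^(n-1) h, in any order and
   with no others: being based at given points does not depend on how the pairs
   (A_k, a_k) are indexed. *)
Definition forward_gaussian (R : realType) (n : nat) (q : R)
    (D : riemann_diff R n) : Prop :=
  codom (@rd_node R n D) =i 0 :: [seq q ^+ i | i <- iota 0 n].

Definition qint (R : realType) (q : R) (k : nat) : R := \sum_(i < k) q ^+ i.

Definition qfact (R : realType) (q : R) (n : nat) : R :=
  \prod_(1 <= i < n.+1) qint q i.

(* Meaningful for k <= n only. *)
Definition qbinom (R : realType) (q : R) (n k : nat) : R :=
  qfact q n / (qfact q (n - k) * qfact q k).

Definition gaussian_tilde (R : realType) (q : R) (n : nat)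
    (x h : R) (f : R -> R) : R :=
  \sum_(k < n) (-1) ^+ k * q ^+ 'C(k.+1, 2) * qbinom q n.-1 k
                 * f (x + q ^+ (n.-1 - k) * h)
  - (\prod_(1 <= i < n) (1 - q ^+ i)) * f x.

Definition gaussian_lambda (R : realType) (q : R) (n : nat) : R :=
  n`!%:R / \prod_(1 <= i < n) (q ^+ n - q ^+ i).

(* Main.v *)
Require Import Defs.
From mathcomp Require Import all_boot all_order all_algebra.
From mathcomp Require Import reals.
From mathcomp Require Import ring.

Import Order.TTheory GRing.Theory Num.Theory.
Local Open Scope ring_scope.

(** A difference of order [n] on at most [n+1] nodes is determined by its
    moments, because every function on the nodes is interpolated by a polynomial
    of degree at most [n]. For the Gaussian nodes, the q-binomial theorem
    [\prod_(1 <= i <= m) (X - q^i) =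
       \sum_k (-1)^k q^'C(k+1,2) [m choose k]_q X^(m-k)]
    with [m = n-1], evaluated at [X = q^j], computes the [j]-th moment of the
    proposed sum: the product vanishes for [1 <= j < n], gives the normalization
    for [j = n], and is cancelled by the [f x] term for [j = 0]. *)

(** Newton's scheme: [w] vanishes on the old nodes but not at the new node [b], so a multiple of [w]
    corrects the value at [b] and leaves the others alone. *)
Lemma interpolation_exists (F : fieldType) (s : seq F) (g : F -> F) :
  uniq s ->
  exists2 p : {poly F}, (size p <= size s)%N & {in s, forall a, p.[a] = g a}.
Proof.
elim: s => [|b s IHs] /=; first by exists 0; rewrite ?size_poly0.
case/andP=> b_notin /IHs[p sz_p p_s].
pose w := \prod_(a <- s) ('X - a%:P).
have wb0 : w.[b] != 0 by rewrite -[_ == 0]/(root w b) root_prod_XsubC.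
exists (p + ((g b - p.[b]) / w.[b]) *: w).
  rewrite (leq_trans (size_polyD _ _)) // geq_max (leq_trans sz_p) //=.
  by rewrite (leq_trans (size_scale_leq _ _)) // size_prod_XsubC.
move=> a; rewrite inE hornerD hornerZ => /orP[/eqP->|a_s].
  by rewrite divfK // addrC subrK.
have /rootP-> : root w a by rewrite root_prod_XsubC.
by rewrite mulr0 addr0 p_s.
Qed.

Section UniqueDetermination.
Set Implicit Arguments.
Unset Strict Implicit.
Unset Printing Implicit Defensive.
Variables (R : realType) (n : nat).
Implicit Types D : riemann_diff R n.

(** By linearity: the moment conditions kill the monomials of degree below [n] and send ['X^n] to
    [n!]. *)
Lemma riemann_diff_horner D (p : {poly R}) : (size p <= n.+1)%N ->
  \sum_(k < (rd_len D).+1) rd_coef k * p.[rd_node k] = p`_n * n`!%:R.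
Proof.
move=> sz_p.
under eq_bigr do rewrite (horner_coef_wide _ sz_p) mulr_sumr.
rewrite exchange_big /=.
under eq_bigr => j _.
  under eq_bigr do rewrite mulrCA.
  rewrite -mulr_sumr rd_moments -1?ltnS //.
  over.
rewrite (bigD1 ord_max) //= eqxx mul1r [X in _ + X]big1 ?addr0 // => j.
by rewrite -val_eqE /= => /negPf->; rewrite mul0r mulr0.
Qed.

Lemma rd_eval_determined D1 D2 (s : seq R) :
  (size s <= n.+1)%N -> codom (@rd_node R n D1) =i s -> codom (@rd_node R n D2) =i s ->
  forall (x h : R) (f : R -> R), rd_eval D1 x h f = rd_eval D2 x h f.
Proof.
move=> sz_s D1s D2s x h f.
(* [s] may contain repetitions, whereas interpolation needs distinct nodes. One [p] serves both
   differences, since it depends only on [s], [f], [x] and [h]. *)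
have [p sz_p p_s] :=
    @interpolation_exists _ _ (fun a => f (x + a * h)) (undup_uniq s).
have {}sz_p : (size p <= n.+1)%N.
  exact: leq_trans sz_p (leq_trans (size_undup s) sz_s).
have evalE D : codom (@rd_node R n D) =i s -> rd_eval D x h f = p`_n * n`!%:R.
  move=> Ds; rewrite -(riemann_diff_horner D) //.
  by apply: eq_bigr => k _; rewrite p_s // mem_undup -Ds codom_f.
by rewrite !evalE.
Qed.

End UniqueDetermination.

Section Gaussian.
Set Implicit Arguments.
Unset Strict Implicit.
Unset Printing Implicit Defensive.
Variables (R : realType) (q : R).
Hypotheses (q_neq0 : q != 0) (q_neq1 : q != 1) (q_neqN1 : q != -1).

(** The only real roots of unity are 1 and -1. Distinctness of the nodes and all nonvanishing
    denominators rest on this. *)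
Lemma expr_neq1 (k : nat) : (0 < k)%N -> q ^+ k != 1.
Proof.
move=> k_gt0; apply/eqP => qk1.
have /eqP : `|q| ^+ k = 1 by rewrite -normrX qk1 normr1.
rewrite pexpr_eq1 // eqr_norml ler01 andbT.
by rewrite (negPf q_neq1) (negPf q_neqN1).
Qed.

Lemma expr_inj : injective (fun k : nat => q ^+ k).
Proof.
have lt_neq i j : (i < j)%N -> q ^+ i != q ^+ j.
  move=> lt_ij; rewrite -(subnKC (ltnW lt_ij)) exprD -{1}[q ^+ i]mulr1.
  by rewrite (inj_eq (mulfI _)) ?expf_neq0 // eq_sym expr_neq1 // subn_gt0.
move=> i j /eqP eq_ij; apply/eqP; case: ltngtP => // /lt_neq.
  by rewrite eq_ij.
by rewrite eq_sym eq_ij.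
Qed.

Lemma qint_neq0 (k : nat) : (0 < k)%N -> qint q k != 0.
Proof.
move=> k_gt0; apply/eqP => qk0.
have := subrX1 q k; rewrite -/(qint q k) qk0 mulr0 => /eqP.
by rewrite subr_eq0 (negPf (expr_neq1 _)).
Qed.

(** * Gaussian binomials and the q-binomial theorem *)

Lemma qfact0 : qfact q 0 = 1.
Proof. by rewrite /qfact big_geq. Qed.

Lemma qfactS (k : nat) : qfact q k.+1 = qfact q k * qint q k.+1.
Proof. by rewrite /qfact big_nat_recr. Qed.

Lemma qfact_neq0 (k : nat) : qfact q k != 0.
Proof.
elim: k => [|k IHk]; first by rewrite qfact0 oner_neq0.
by rewrite qfactS mulf_neq0 ?qint_neq0.
Qed.

Lemma qintD (d k : nat) : qint q (d + k) = qint q d + q ^+ d * qint q k.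
Proof.
rewrite /qint big_split_ord mulr_sumr /=; congr (_ + _).
by apply: eq_bigr => i _; rewrite exprD.
Qed.

Lemma qbinom0 (m : nat) : qbinom q m 0 = 1.
Proof. by rewrite /qbinom qfact0 mulr1 subn0 divff ?qfact_neq0. Qed.

Lemma qbinomn (m : nat) : qbinom q m m = 1.
Proof. by rewrite /qbinom subnn qfact0 mul1r divff ?qfact_neq0. Qed.

Lemma qbinom_neq0 (m k : nat) : qbinom q m k != 0.
Proof. by rewrite mulf_neq0 ?invr_neq0 ?mulf_neq0 ?qfact_neq0. Qed.

(** The q-Pascal rule, obtained from [[m+1] = [m-k] + q^(m-k) [k+1]] over a common denominator. *)
Lemma qbinomS (m k : nat) : (k < m)%N ->
  qbinom q m.+1 k.+1 = qbinom q m k.+1 + q ^+ (m - k) * qbinom q m k.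
Proof.
move=> lt_km; rewrite /qbinom subSS -(subnSK lt_km).
set d := (m - k.+1)%N; rewrite !qfactS.
have -> : qint q m.+1 = qint q d.+1 + q ^+ d.+1 * qint q k.+1.
  by rewrite -qintD; congr (qint q _); rewrite /d subnSK // addnS subnK // ltnW.
have d0 := qfact_neq0 d; have k0 := qfact_neq0 k.
have dS0 := qint_neq0 (ltn0Sn d); have kS0 := qint_neq0 (ltn0Sn k).
by field; rewrite d0 k0 dS0 kS0.
Qed.

Definition gaussian_coef (m k : nat) : R :=
  (-1) ^+ k * q ^+ 'C(k.+1, 2) * qbinom q m k.

Lemma gaussian_coef_neq0 (m k : nat) : gaussian_coef m k != 0.
Proof. by rewrite mulf_neq0 ?qbinom_neq0 // mulf_neq0 ?signr_eq0 ?expf_neq0. Qed.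

Lemma gaussian_coef0 (m : nat) : gaussian_coef m 0 = 1.
Proof. by rewrite /gaussian_coef qbinom0 !mul1r. Qed.

Lemma gaussian_coefS (m k : nat) : (k < m)%N ->
  gaussian_coef m.+1 k.+1 =
    gaussian_coef m k.+1 - q ^+ m.+1 * gaussian_coef m k.
Proof.
move=> lt_km; rewrite /gaussian_coef qbinomS // binS bin1 exprD.
have -> : q ^+ m.+1 = q ^+ (m - k) * q ^+ k.+1.
  by rewrite -exprD addnS subnK // ltnW.
by rewrite [(-1) ^+ k.+1]exprS; ring.
Qed.

(** The top coefficient is treated apart: by truncated subtraction [qbinom q m m.+1] is [1/[m+1]],
    not 0, so the previous recurrence fails at [k = m]. *)
Lemma gaussian_coefSn (m : nat) :
  gaussian_coef m.+1 m.+1 = - (q ^+ m.+1 * gaussian_coef m m).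
Proof. by rewrite /gaussian_coef !qbinomn binS bin1 exprD [(-1) ^+ _]exprS; ring. Qed.

Lemma gauss_binomial (m : nat) (y : R) :
  \sum_(k < m.+1) gaussian_coef m k * y ^+ (m - k) =
    \prod_(1 <= i < m.+1) (y - q ^+ i).
Proof.
elim: m => [|m IHm].
  by rewrite big_ord1 big_geq // gaussian_coef0 mulr1.
rewrite big_nat_recr //= -IHm mulrBr !mulr_suml.
(* The leading and constant terms in [y] are split off; the inner ones then match through
   [gaussian_coefS]. *)
rewrite big_ord_recl big_ord_recr /= subnn mulr1 gaussian_coefSn.
rewrite [X in _ = X - _]big_ord_recl [X in _ = _ - X]big_ord_recr /=.
rewrite !gaussian_coef0 !subn0 subnn !mul1r mulr1 -exprSr opprD.
rewrite -addrA; congr (_ + _); rewrite addrA [q ^+ _ * _]mulrC; congr (_ - _).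
rewrite -sumrB; apply: eq_bigr => k _ /=; rewrite /bump add1n subSS.
rewrite gaussian_coefS // -(subnSK (ltn_ord k)) [y ^+ _.+1]exprS; ring.
Qed.

(** * The explicit Gaussian difference *)

Definition gaussian_node (k : nat) : R := if k is j.+1 then q ^+ j else 0.

Definition gaussian_weight (n k : nat) : R :=
  gaussian_lambda q n *
    (if k is j.+1 then gaussian_coef n.-1 (n.-1 - j)
     else - \prod_(1 <= i < n) (1 - q ^+ i)).

Lemma gaussian_node_inj : injective gaussian_node.
Proof.
move=> [|i] [|j] //= => [/esym/eqP|/eqP|/expr_inj-> //];
  by rewrite expf_eq0 (negPf q_neq0) andbF.
Qed.

(** Used with [m = n] for the denominator of [gaussian_lambda], and with [m = 0] for the weight at
    the node 0. *)
Lemma prod_expB_neq0 (n m : nat) : (forall i, 0 < i < n -> i != m)%N ->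
  \prod_(1 <= i < n) (q ^+ m - q ^+ i) != 0.
Proof.
move=> neq_m; rewrite prodf_seq_neq0; apply/allP => i; rewrite mem_index_iota => lt_i.
by rewrite subr_eq0 (inj_eq expr_inj) eq_sym neq_m.
Qed.

Lemma gaussian_norm_neq0 (n : nat) : \prod_(1 <= i < n) (q ^+ n - q ^+ i) != 0.
Proof. by apply: prod_expB_neq0 => i /andP[_ /ltn_eqF->]. Qed.

Lemma gaussian_lambda_neq0 (n : nat) : gaussian_lambda q n != 0.
Proof.
by rewrite mulf_neq0 ?invr_neq0 ?gaussian_norm_neq0 // pnatr_eq0 -lt0n fact_gt0.
Qed.

Lemma gaussian_weight_neq0 (n k : nat) : gaussian_weight n k != 0.
Proof.
rewrite mulf_neq0 ?gaussian_lambda_neq0 //; case: k => [|j].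
  by rewrite oppr_eq0 (@prod_expB_neq0 n 0) // => i /andP[/gtn_eqF->].
exact: gaussian_coef_neq0.
Qed.

(** Kept general in [g]: powers give the moments, and [y |-> f (x + y * h)] gives the value of the
    difference. *)
Lemma gaussian_weight_sum (n : nat) (g : R -> R) : (0 < n)%N ->
  \sum_(k < n.+1) gaussian_weight n k * g (gaussian_node k) =
    gaussian_lambda q n *
      (\sum_(k < n) gaussian_coef n.-1 k * g (q ^+ (n.-1 - k))
       - (\prod_(1 <= i < n) (1 - q ^+ i)) * g 0).
Proof.
case: n => // m _; rewrite big_ord_recl /= addrC mulrBr -mulrA mulNr mulrN.
congr (_ - _); rewrite mulr_sumr (reindex_inj rev_ord_inj) /=.
apply: eq_bigr => k _; rewrite /gaussian_weight /= subSS -mulrA.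
by rewrite subKn // -ltnS.
Qed.

Lemma gaussian_moments (n : nat) : (0 < n)%N -> forall j, (j <= n)%N ->
  \sum_(k < n.+1) gaussian_weight n k * gaussian_node k ^+ j =
    (j == n)%:R * n`!%:R.
Proof.
move=> n_gt0 j le_jn.
rewrite (@gaussian_weight_sum _ (fun y => y ^+ j)) //.
(* Swapping the exponents exhibits powers of [q ^+ j], the point at which [gauss_binomial] is
   applied. *)
under [X in X - _]eq_bigr do rewrite exprAC.
case: n n_gt0 le_jn => // m _ le_jn; rewrite gauss_binomial expr0n.
have [->|j_gt0] := posnP j; first by rewrite mulr1 subrr mulr0 mul0r.
rewrite mulr0 subr0; have [->|neq_jn] := eqVneq j m.+1.
  by rewrite divfK ?gaussian_norm_neq0 // mul1r.
have lt_jn : (j < m.+1)%N by rewrite ltn_neqAle neq_jn.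
rewrite (bigD1_seq j) ?iota_uniq ?mem_index_iota ?j_gt0 //=.
by rewrite subrr !mul0r mulr0.
Qed.

Lemma gaussian_node_ord_inj (n : nat) :
  injective (fun k : 'I_n.+1 => gaussian_node k).
Proof. by move=> i j /gaussian_node_inj/val_inj. Qed.

Definition gaussian_diff (n : nat) (n_gt0 : (0 < n)%N) : riemann_diff R n :=
  @RiemannDiff R n n (fun k => gaussian_weight n k) (fun k => gaussian_node k)
    (fun k => gaussian_weight_neq0 n k) (@gaussian_node_ord_inj n)
    (gaussian_moments n_gt0).

Lemma gaussian_diff_forward (n : nat) (n_gt0 : (0 < n)%N) :
  forward_gaussian q (gaussian_diff n_gt0).
Proof.
move=> y; rewrite inE; apply/codomP/predU1P => /=.
  case=> -[[|j] /= lt_j] ->; [by left | right].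
  by apply: map_f; rewrite mem_iota.
case=> [->|/mapP[i]]; first by exists ord0.
by rewrite mem_iota /= add0n => lt_in ->; exists (lift ord0 (Ordinal lt_in)).
Qed.

Lemma gaussian_diff_eval (n : nat) (n_gt0 : (0 < n)%N) (x h : R) (f : R -> R) :
  rd_eval (gaussian_diff n_gt0) x h f =
    gaussian_lambda q n * gaussian_tilde q n x h f.
Proof.
rewrite /rd_eval (@gaussian_weight_sum _ (fun y => f (x + y * h))) //.
by rewrite mul0r addr0.
Qed.

End Gaussian.

Theorem lemma1p1 (R : realType) (q : R) (n : nat)
    (q_neq0 : q != 0) (q_neq1 : q != 1) (q_neqN1 : q != -1)
    (n_gt0 : (0 < n)%N) :
  (exists D : riemann_diff R n, forward_gaussian q D) /\
  (forall D : riemann_diff R n, forward_gaussian q D ->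
     forall (x h : R) (f : R -> R),
       rd_eval D x h f = gaussian_lambda q n * gaussian_tilde q n x h f).
Proof.
(* [D0] is both the witness for existence and the difference to which any other one is compared. *)
pose D0 := gaussian_diff q_neq0 q_neq1 q_neqN1 n_gt0.
have D0q : forward_gaussian q D0 by exact: gaussian_diff_forward.
split=> [|D Dq x h f]; first by exists D0.
rewrite -(gaussian_diff_eval q_neq0 q_neq1 q_neqN1 n_gt0).
by apply: rd_eval_determined Dq D0q _ _ _; rewrite /= size_map size_iota.
Qed.
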